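(* For all integers $k,l\ge 0$ and all real $x,t$, $$\frac{\partial^{l}f_{\mathbb{B},k}(x,t)}{\partial x^{l}}=\sum_{j=0}^{l}\binom{l}{j}(-1)^{l-j}t^{l}f_{\mathbb{B},k-j}(x,t),$$ where $f_{\mathbb{B},k}$ is the generating function $f_{\mathbb{B},k}(x,t)=\sum_{n=0}^{\infty}B_k^n(x)\frac{t^n}{n!}$ of the Bernstein basis functions.
   Context: The Bernstein basis functions are $B_k^n(x)=\binom{n}{k}x^k(1-x)^{n-k}$ for integers $0\le k\le n$, with the convention that $B_k^n(x)=0$ when $k<0$ or $k>n$ (and $0^0=1$). In particular $f_{\mathbb{B},k}=0$ for $k<0$, and $f_{\mathbb{B},k}(x,t)=\frac{t^kx^k}{k!}e^{(1-x)t}$ for $k\ge 0$. *)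

(* Defs.v *)
From Stdlib Require Import Reals ZArith Lia Lra.
From Coquelicot Require Import Coquelicot.

Open Scope R_scope.

(* [B_k^n(x)], with the index [k] in [Z] so that the convention [B_k^n = 0]
   for [k < 0] or [k > n] is meaningful.  The guard [k <= n] is needed because
   [Binomial.C n k] is not 0 for [k > n]; the name is qualified because
   Coquelicot uses [C] for the complex numbers. *)
Definition bernstein (n : nat) (k : Z) (x : R) : R :=
  if andb (0 <=? k)%Z (k <=? Z.of_nat n)%Z
  then Binomial.C n (Z.to_nat k) * x ^ Z.to_nat k * (1 - x) ^ (n - Z.to_nat k)
  else 0.

Definition fB (k : Z) (x t : R) : R :=
  Series (fun n : nat => bernstein n k x * (t ^ n / INR (fact n))).

(* [Series] is total; this shows that in [fB] it is always a genuine sum. *)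
Lemma ex_series_fB (k : Z) (x t : R) :
  ex_series (fun n : nat => bernstein n k x * (t ^ n / INR (fact n))).
Proof.
destruct (Z_lt_le_dec k 0) as [Hk | Hk].
- apply ex_series_ext with (fun _ : nat => 0).
  + intros n; unfold bernstein.
    replace (0 <=? k)%Z with false by (symmetry; apply Z.leb_gt; lia).
    simpl; ring.
  + exists 0; apply is_series_Reals; intros e He; exists 0%nat; intros n _.
    rewrite sum_eq_R0 by reflexivity.
    now rewrite R_dist_eq.
- apply (ex_series_incr_n _ (Z.to_nat k)).
  set (m := Z.to_nat k).
  apply ex_series_ext with
    (fun n : nat =>
       ((t * x) ^ m / INR (fact m)) * (/ INR (fact n) * ((1 - x) * t) ^ n)).
  + intros n; unfold bernstein; fold m.
    replace (0 <=? k)%Z with true by (symmetry; apply Z.leb_le; lia).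
    replace (k <=? Z.of_nat (m + n))%Z with true
      by (symmetry; apply Z.leb_le; lia).
    unfold Binomial.C; simpl.
    replace (m + n - m)%nat with n by lia.
    rewrite pow_add, !Rpow_mult_distr.
    field; repeat split; apply INR_fact_neq_0.
  + apply (ex_series_scal_l (V := R_NormedModule)).
    exists (exp ((1 - x) * t)).
    apply is_pseries_R, is_exp_Reals.
Qed.

(* Main.v *)
(* Summing the series gives [fB k x t = (t x)^k / k! * e^((1-x) t)] for [k >= 0]
   and [0] for [k < 0], whence [d/dx fB k = t (fB (k-1) - fB k)].  Thus
   [d/dx] acts as [t (E - 1)], with [E] the shift [k |-> k-1], and the formula
   is the binomial expansion of [t^l (E - 1)^l]. *)
Require Import Defs.
From Stdlib Require Import Reals ZArith Lia.
From Coquelicot Require Import Coquelicot.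
Open Scope R_scope.

Lemma bernstein_out (n : nat) (k : Z) (x : R) :
  (k < 0 \/ Z.of_nat n < k)%Z -> bernstein n k x = 0.
Proof.
intros H; unfold bernstein.
destruct (Z.leb_spec 0 k); destruct (Z.leb_spec k (Z.of_nat n));
  simpl; trivial; lia.
Qed.

Lemma fB_neg (k : Z) (x t : R) : (k < 0)%Z -> fB k x t = 0.
Proof.
intros Hk; unfold fB.
(* Writing each zero term as [0 * 0] lets [Series_scal_l] pull out a factor 0, with no convergence
   argument. *)
rewrite (Series_ext _ (fun n => 0 * 0)).
- rewrite Series_scal_l; ring.
- intros n; rewrite bernstein_out by lia; ring.
Qed.

(** The factorial [(m + n)!] cancels against the one in the binomial coefficient, leaving a factor
    free of [n] times a term of the exponential series. *)
Lemma bernstein_exp_term (m n : nat) (x t : R) :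
  bernstein (m + n) (Z.of_nat m) x * (t ^ (m + n) / INR (fact (m + n))) =
  (t * x) ^ m / INR (fact m) * (/ INR (fact n) * ((1 - x) * t) ^ n).
Proof.
unfold bernstein.
replace (0 <=? Z.of_nat m)%Z with true by (symmetry; apply Z.leb_le; lia).
replace (Z.of_nat m <=? Z.of_nat (m + n))%Z with true
  by (symmetry; apply Z.leb_le; lia).
rewrite Nat2Z.id; unfold Binomial.C; simpl.
replace (m + n - m)%nat with n by lia.
rewrite pow_add, !Rpow_mult_distr.
field; repeat split; apply INR_fact_neq_0.
Qed.

Lemma fB_closed (m : nat) (x t : R) :
  fB (Z.of_nat m) x t = (t * x) ^ m / INR (fact m) * exp ((1 - x) * t).
Proof.
assert (Htail : Series (fun n => bernstein (m + n) (Z.of_nat m) x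
                   * (t ^ (m + n) / INR (fact (m + n))))
                = (t * x) ^ m / INR (fact m) * exp ((1 - x) * t)).
{ rewrite (Series_ext _ _ (fun n => bernstein_exp_term m n x t)).
  rewrite Series_scal_l, exp_Reals; reflexivity. }
(* [Series_incr_n] must drop at least one term; for [m = 0] the tail is the whole series. For [S m],
   the dropped terms vanish because their degree is below [S m]. *)
destruct m as [|m]; [exact Htail|].
unfold fB; rewrite (Series_incr_n _ (S m)); [|lia|apply ex_series_fB].
rewrite Htail; simpl pred.
rewrite sum_eq_R0; [ring|].
intros n Hn; rewrite bernstein_out by lia; ring.
Qed.

(** Negative [k] is included because the indices [k - j] of the final formula may drop below 0. *)
Lemma is_derive_fB (k : Z) (x t : R) :
  is_derive (fun y => fB k y t) x (t * (fB (k - 1) x t - fB k x t)).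
Proof.
destruct (Z_lt_le_dec k 0) as [Hk|Hk].
- rewrite !fB_neg by lia.
  apply is_derive_ext with (fun _ => 0).
  + intros y; rewrite fB_neg; trivial.
  + auto_derive; trivial; ring.
- rewrite <- (Z2Nat.id k Hk); generalize (Z.to_nat k); intros m.
  eapply is_derive_ext; [intros y; symmetry; apply fB_closed|].
  rewrite fB_closed.
  destruct m as [|m].
  + rewrite fB_neg by lia; simpl.
    auto_derive; trivial; unfold Rminus; field.
  + replace (Z.of_nat (S m) - 1)%Z with (Z.of_nat m) by lia.
    rewrite fB_closed, fact_simpl, mult_INR.
    assert (Hm : INR (S m) <> 0) by (apply not_0_INR; lia).
    pose proof (INR_fact_neq_0 m).
    auto_derive; trivial.
    (* The exponent brought down by differentiation is refolded so that it cancels the factor [S m]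
       of [(S m)!]. *)
    change (match m with 0%nat => 1 | S _ => INR m + 1 end) with (INR (S m)).
    rewrite <- tech_pow_Rmult; unfold Rminus.
    field; split; assumption.
Qed.

Lemma is_derive_sum_f_R0 (f : nat -> R -> R) (df : nat -> R) (n : nat) (x : R) :
  (forall j, is_derive (f j) x (df j)) ->
  is_derive (fun y => sum_f_R0 (fun j => f j y) n) x (sum_f_R0 df n).
Proof.
intros H; induction n as [|n IH]; simpl; [apply H|].
exact (is_derive_plus _ _ _ _ _ IH (H (S n))).
Qed.

(** This is [(E - 1)^l (E - 1) = (E - 1)^(l+1)] applied to a sequence, by Pascal's rule. *)
Lemma sum_binomial_difference (a : nat -> R) (l : nat) :
  sum_f_R0 (fun j => Binomial.C l j * (-1) ^ (l - j) * (a (S j) - a j)) l =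
  sum_f_R0 (fun j => Binomial.C (S l) j * (-1) ^ (S l - j) * a j) (S l).
Proof.
destruct l as [|m].
- unfold Binomial.C; simpl; field.
- rewrite (sum_eq _ (fun j =>
    Binomial.C (S m) j * (-1) ^ (S m - j) * a (S j)
    - Binomial.C (S m) j * (-1) ^ (S m - j) * a j)) by (intros; ring).
  (* Boundary terms are split off until every sum runs over [a (S i)] with [i <= m], where Pascal's
     rule applies. *)
  rewrite minus_sum, (decomp_sum _ (S (S m))) by lia.
  rewrite (decomp_sum (fun j => Binomial.C (S m) j * (-1) ^ (S m - j) * a j))
    by lia.
  simpl pred; rewrite !tech5.
  rewrite (sum_eq (fun i => Binomial.C (S (S m)) (S i) * _ * _) (fun i =>
    Binomial.C (S m) i * (-1) ^ (S m - i) * a (S i)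
    - Binomial.C (S m) (S i) * (-1) ^ (S m - S i) * a (S i))).
  (* Only boundary terms remain, with coefficients [C n 0] or [C n n], all equal to 1. *)
  + rewrite minus_sum, !pascal_step1 with (i := 0%nat) by lia.
    rewrite !Nat.sub_0_r, !Nat.sub_diag.
    rewrite !(fun n => pascal_step1 n n (le_n n)), !Nat.sub_diag.
    assert (HC : forall n, Binomial.C n 0 = 1).
    { intros n; unfold Binomial.C; rewrite Nat.sub_0_r; simpl.
      field; apply INR_fact_neq_0. }
    assert (HCn : forall n, Binomial.C n n = 1).
    { intros n; rewrite pascal_step1, Nat.sub_diag by lia; apply HC. }
    rewrite ?HC, ?HCn; simpl; ring.
  + intros i Hi; rewrite <- pascal by lia.
    replace (S (S m) - S i)%nat with (S (m - i)) by lia.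
    replace (S m - i)%nat with (S (m - i)) by lia.
    replace (S m - S i)%nat with (m - i)%nat by lia.
    simpl; ring.
Qed.

Theorem theorem6 (k l : nat) (x t : R) :
  is_derive_n (fun y : R => fB (Z.of_nat k) y t) l x
    (sum_f_R0 (fun j : nat =>
       Binomial.C l j * (-1) ^ (l - j) * t ^ l
         * fB (Z.of_nat k - Z.of_nat j) x t) l).
Proof.
revert x; induction l as [|l IH]; intros x.
- simpl; rewrite Z.sub_0_r; unfold Binomial.C; simpl; field.
- cbn [is_derive_n].
  (* The induction hypothesis, available at every point, identifies the [l]-th derivative as a
     function. *)
  eapply is_derive_ext;
    [intros y; symmetry; apply is_derive_n_unique, IH|].
  set (a := fun j => t ^ S l * fB (Z.of_nat k - Z.of_nat j) x t).
  rewrite (sum_eq _ (fun j => Binomial.C (S l) j * (-1) ^ (S l - j) * a j))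
    by (intros; unfold a; ring).
  rewrite <- sum_binomial_difference.
  apply is_derive_sum_f_R0; intros j.
  (* One factor of [t ^ S l] goes to the derivative of [fB (k - j)]; the other [t ^ l] is a constant
     in [x]. *)
  replace (Binomial.C l j * (-1) ^ (l - j) * (a (S j) - a j)) with
    (Binomial.C l j * (-1) ^ (l - j) * t ^ l
     * (t * (fB (Z.of_nat k - Z.of_nat j - 1) x t
             - fB (Z.of_nat k - Z.of_nat j) x t))).
  + apply is_derive_scal, is_derive_fB.
  + unfold a.
    replace (Z.of_nat k - Z.of_nat (S j))%Z
      with (Z.of_nat k - Z.of_nat j - 1)%Z by lia.
    simpl; ring.
Qed.
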